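(* Let $p$ be a prime and $k\ge0$. Let $\mathcal V_{k+1,p}$ be the $\mathbb{C}$-vector space of functions $\mathbb Z_p^{k+1}\to\mathbb{C}$. For $0\le\ell\le k$ let $F_\ell$ be the set of functions $(x_1,\dots,x_{k+1})\mapsto\alpha_1x_1\oplus\dots\oplus\alpha_\ell x_\ell\oplus x_{\ell+1}\oplus\beta$ with $\alpha_i\in\{0,\dots,p-1\}$ and $\beta\in\{0,\dots,p-2\}$, where $\oplus$ is addition modulo $p$ and the value in $\{0,\dots,p-1\}$ is regarded as a complex number, and let $\mathcal F_k=F_k\cup\dots\cup F_0\cup\{1\}$ ($1$ the constant function). Then $\mathcal F_k$ is linearly independent in $\mathcal V_{k+1,p}$ and forms a basis of $\mathcal V_{k+1,p}$. *)

(* Defs.v *)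
From HB Require Import structures.
From mathcomp Require Import all_boot all_order all_algebra.
From mathcomp Require Import finmap complex reals.

Set Implicit Arguments.
Unset Strict Implicit.
Unset Printing Implicit Defensive.

Import GRing.Theory.
Local Open Scope ring_scope.

(* 'Z_p is the ring of integers modulo p only for 1 < p; everything below is
   meant for p prime.  Coordinates are numbered from 0, so x_(i+1) is x i. *)
Notation Zpoint p k := {ffun 'I_k.+1 -> 'Z_p}.

(* R[i]^o is R[i] seen as a vector space over itself. *)
Notation Vfun R p k := {ffun Zpoint p k -> R[i]^o}.

Section Functions.
Variables (R : realType) (p k : nat).

(* The sum is computed in 'Z_p; its representative in {0, ..., p - 1} is then
   cast to R[i]. *)
Definition affine_fun (l : 'I_k.+1) (a : {ffun 'I_l -> 'Z_p}) (b : 'I_p.-1) :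
    Vfun R p k :=
  [ffun x : Zpoint p k =>
    (nat_of_ord
      (\sum_(i < l) a i * x (widen_ord (ltnW (ltn_ord l)) i)
       + x l + b%:R : 'Z_p))%:R].

Definition const1 : Vfun R p k := [ffun=> 1].

Definition F_ (l : 'I_k.+1) : {fset Vfun R p k} :=
  [fset affine_fun a b | a in {: {ffun 'I_l -> 'Z_p}}, b in {: 'I_p.-1}]%fset.

Definition calF : {fset Vfun R p k} :=
  (\big[fsetU/fset0]_(l < k.+1) F_ l `|` [fset const1])%fset.

End Functions.

(* Main.v *)
(* Put n = k + 1.  Since calF has at most 1 + sum_(l <= k) p^l (p - 1) = p^n =
   dim V elements, it is enough to show that it spans V.
   For a linear form f = a_1 x_1 + ... + a_l x_l + x_(l+1), the sum of f (+) b
   over all b in Z_p is constant, so f (+) b is in the span for b = p - 1 too.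
   As (t (-) 1) - t = -1 + p [t = 0], the indicator function of every
   hyperplane f (+) b = 0 is in the span, hence that of every affine hyperplane,
   by scaling its equation so that its last nonzero coefficient is 1.
   Finally the sum over all linear forms f of the indicator functions of
   f(x) = f(x0) is p^n at x0 and p^(n-1) elsewhere, which gives the indicator
   functions of points. *)
Require Import Defs.
From HB Require Import structures.
From mathcomp Require Import all_boot all_order all_algebra.
From mathcomp Require Import finmap complex reals.

Set Implicit Arguments.
Unset Strict Implicit.
Unset Printing Implicit Defensive.

Import GRing.Theory Num.Theory.
Local Open Scope ring_scope.

Section Zp.
Variable p : nat.

(** Decrementing a residue lowers its representative by one, except at [t = 0], where it wraps
    around to [p - 1]. The additive form avoids truncated subtraction in [nat]. *)
Lemma Zp_sub1 (t : 'Z_p) : (1 < p)%N ->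
  ((t - 1)%R + 1 = t + p * (t == 0%R))%N.
Proof.
case: p t => [|[|q]] // t _; have [->|t_neq0] := eqVneq t 0.
  by rewrite sub0r /= modn_small ?modn_small // subn1 addn1 muln1.
have [u Du] : exists u, nat_of_ord t = u.+1.
  by case E: (nat_of_ord t) => [|u]; [case/eqP: t_neq0; apply/ord_inj | exists u].
have ltu : (u.+1 < q.+2)%N by rewrite -Du.
have -> : t = u%:R + 1.
  by apply/ord_inj; rewrite natr1 val_Zp_nat // modn_small.
rewrite addrK natr1 !val_Zp_nat // modn_small ?(ltnW ltu) //.
by rewrite modn_small // addn1 muln0 addn0.
Qed.

Lemma Zp_unit (x : 'Z_p) : prime p -> x != 0 -> x \is a GRing.unit.
Proof.
move=> p_prime x_neq0; have p_gt1 := prime_gt1 p_prime.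
rewrite -(natr_Zp x) unitZpE // prime_coprime //; apply: contra x_neq0 => p_x.
rewrite -(natr_Zp x); apply/eqP/val_inj; rewrite /= val_Zp_nat //.
exact/eqP.
Qed.

Lemma card_Zp_ffun (T : finType) : (1 < p)%N -> #|{ffun T -> 'Z_p}| = (p ^ #|T|)%N.
Proof. by move=> p_gt1; rewrite card_ffun card_ord Zp_cast. Qed.

(** For [z != 0] the form [a |-> \sum_i a i * z i] is onto ['Z_p]; its [p] fibres are translates of
    the kernel and partition a set of size [p ^ n.+1]. *)
Lemma sum_dual_kernel (n : nat) (z : {ffun 'I_n.+1 -> 'Z_p}) : prime p ->
  (\sum_(a : {ffun 'I_n.+1 -> 'Z_p}) ((\sum_i a i * z i)%R == 0%R) =
   if z == 0%R then p ^ n.+1 else p ^ n)%N.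
Proof.
move=> p_prime; have p_gt1 := prime_gt1 p_prime.
have card_dual : #|{ffun 'I_n.+1 -> 'Z_p}| = (p ^ n.+1)%N.
  by rewrite card_Zp_ffun ?card_ord.
case: eqVneq => [-> | z_neq0].
  rewrite -card_dual -sum1_card; apply: eq_bigr => a _.
  by rewrite big1 ?eqxx // => i _; rewrite ffunE mulr0.
have [i zi] : exists i, z i != 0.
  apply/existsP; apply: contra_neqT z_neq0 => /existsPn z0.
  by apply/ffunP=> i; rewrite ffunE; apply/eqP; rewrite -[_ == _]negbK z0.
apply/eqP; rewrite -(eqn_pmul2l (prime_gt0 p_prime)) -expnS; apply/eqP.
transitivity (\sum_(c : 'Z_p) \sum_(a : {ffun 'I_n.+1 -> 'Z_p})
                 ((\sum_i a i * z i)%R == c))%N; last first.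
  rewrite exchange_big -card_dual -sum1_card; apply: eq_bigr => a _ /=.
  by rewrite (bigD1 (\sum_i a i * z i)%R) //= eqxx big1 // => c /negPf;
     rewrite eq_sym => ->.
rewrite -{1}(Zp_cast p_gt1) -[X in (X * _)%N]card_ord -sum_nat_const.
apply: eq_bigr => c _.
(* The vector [e] lies in the fibre over [c], so adding it carries the kernel onto that fibre. *)
pose e : {ffun 'I_n.+1 -> 'Z_p} := [ffun j => if j == i then c / z i else 0].
have ze : \sum_j e j * z j = c.
  rewrite (bigD1 i) //= big1 ?addr0 => [|j /negPf ji]; rewrite ffunE.
    by rewrite eqxx mulrVK ?Zp_unit.
  by rewrite ji mul0r.
rewrite [RHS](reindex_inj (addrI e)); apply: eq_bigr => a _.
under [X in _ = nat_of_bool (X == _)]eq_bigr => j _ do rewrite ffunE mulrDl.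
by rewrite big_split /= ze -[in RHS]subr_eq0 addrAC subrr add0r.
Qed.

End Zp.

Section Span.
Variables (R : realType) (p k : nat).
Hypothesis p_prime : prime p.

Let p_gt1 : (1 < p)%N := prime_gt1 p_prime.
Let W : {vspace Vfun R p k} := <<calF R p k>>%VS.

Definition monic_form (l : 'I_k.+1) (a : {ffun 'I_l -> 'Z_p})
    (x : Zpoint p k) : 'Z_p :=
  \sum_(i < l) a i * x (widen_ord (ltnW (ltn_ord l)) i) + x l.

Lemma const1_span : const1 R p k \in W.
Proof. by apply: memv_span; rewrite !inE eqxx orbT. Qed.

Lemma affine_fun_span (l : 'I_k.+1) (a : {ffun 'I_l -> 'Z_p}) (b : 'I_p.-1) :
  affine_fun R a b \in W.
Proof.
apply: memv_span; apply/fsetUP; left.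
apply/bigfcupP; exists l; first by rewrite mem_index_enum.
by apply: in_imfset2.
Qed.

Lemma shifted_form_span (l : 'I_k.+1) (a : {ffun 'I_l -> 'Z_p}) (b : 'Z_p) :
  [ffun x => (nat_of_ord (monic_form a x + b))%:R] \in W.
Proof.
have span_small (c : 'Z_p) : (c < p.-1)%N ->
    [ffun x => (nat_of_ord (monic_form a x + c))%:R] \in W.
  move=> ltc; have := affine_fun_span a (Ordinal ltc).
  by congr (_ \in W); apply/ffunP => x; rewrite !ffunE /= natr_Zp.
have [/span_small // | geb] := ltnP b p.-1.
(* As [c] runs through ['Z_p], so does [monic_form a x + c]; the sum over all shifts is thus
   independent of [x]. *)
have -> : [ffun x => (nat_of_ord (monic_form a x + b))%:R] =
    (\sum_(c : 'Z_p) nat_of_ord c)%N%:R *: const1 R p k -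
    \sum_(c | c != b) [ffun x => (nat_of_ord (monic_form a x + c))%:R].
  apply/ffunP => x; rewrite !ffunE sum_ffunE.
  rewrite [X in X%:R *: _](reindex_inj (addrI (monic_form a x))) /=.
  rewrite (bigD1 b) //= natrD /GRing.scale /= mulr1 natr_sum.
  by under [X in _ - X]eq_bigr => c _ do rewrite ffunE; rewrite addrK.
apply: rpredB; first by rewrite rpredZ ?const1_span.
apply: rpred_sum => c cb; apply: span_small.
(* Here [b] must be [p - 1], so every other shift [c] is below [p.-1]. *)
have le_pred (d : 'Z_p) : (d <= p.-1)%N.
  rewrite -ltnS prednK ?prime_gt0 // -[X in (_ < X)%N](Zp_cast p_gt1).
  exact: ltn_ord.
rewrite ltn_neqAle le_pred andbT; apply: contra cb => /eqP Dc.
by apply/eqP/ord_inj/eqP; rewrite Dc eqn_leq geb le_pred.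
Qed.

Lemma monic_hyperplane_span (l : 'I_k.+1) (a : {ffun 'I_l -> 'Z_p}) (b : 'Z_p) :
  [ffun x => (monic_form a x + b == 0)%:R] \in W.
Proof.
have p_neq0 : p%:R != 0 :> R[i] by rewrite pnatr_eq0 -lt0n prime_gt0.
have step (t : 'Z_p) : (nat_of_ord (t - 1))%:R - (nat_of_ord t)%:R + 1 =
    p%:R * (t == 0)%:R :> R[i].
  by rewrite addrAC natr1 -addn1 Zp_sub1 // natrD natrM addrAC subrr add0r.
have -> : [ffun x => (monic_form a x + b == 0)%:R] = (p%:R : R[i])^-1 *:
    ([ffun x => (nat_of_ord (monic_form a x + (b - 1)))%:R] -
     [ffun x => (nat_of_ord (monic_form a x + b))%:R] + const1 R p k).
  apply/ffunP => x; rewrite !ffunE (addrA (monic_form a x)).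
  by rewrite -[LHS](mulKf p_neq0) -step.
by rewrite rpredZ // rpredD ?const1_span // rpredB ?shifted_form_span.
Qed.

Lemma hyperplane_span (a : {ffun 'I_k.+1 -> 'Z_p}) (b : 'Z_p) :
  [ffun x : Zpoint p k => (\sum_i a i * x i + b == 0)%:R] \in W.
Proof.
have [/existsP[l0 al0] | /existsPn a0] := boolP [exists l, a l != 0]; last first.
  have -> : [ffun x : Zpoint p k => (\sum_i a i * x i + b == 0)%:R] =
      ((b == 0)%:R : R[i]) *: const1 R p k.
    apply/ffunP => x; rewrite !ffunE /GRing.scale /= mulr1 big1 ?add0r // => i _.
    by have := a0 i; rewrite negbK => /eqP ->; rewrite mul0r.
  by rewrite rpredZ ?const1_span.
(* [l] is the last index with a nonzero coefficient; dividing the equation by the unit [a l] makes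
   the form monic. *)
case: (@arg_maxnP _ l0 (fun l => a l != 0) val al0) => l al max_l.
pose a' : {ffun 'I_l -> 'Z_p} :=
  [ffun i => (a l)^-1 * a (widen_ord (ltnW (ltn_ord l)) i)].
have := monic_hyperplane_span a' ((a l)^-1 * b); congr (_ \in W).
apply/ffunP => x; rewrite !ffunE; congr (_%:R).
have al_unit := Zp_unit p_prime al.
suff -> : \sum_i a i * x i + b = a l * (monic_form a' x + (a l)^-1 * b).
  by rewrite -[X in _ = nat_of_bool (_ == X)](mulr0 (a l)) (inj_eq (mulrI _)).
rewrite !mulrDr mulVKr //; congr (_ + _).
(* Indices below [l] give the rescaled coefficients; among the others only [l] contributes, by
   maximality. *)
rewrite (bigID (fun i : 'I_k.+1 => (i < l)%N)) /=; congr (_ + _).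
  rewrite (big_ord_narrow (ltnW (ltn_ord l))) mulr_sumr.
  by apply: eq_bigr => i _; rewrite ffunE mulrA mulVKr.
rewrite (bigD1 l) ?ltnn //= big1 ?addr0 // => i /andP[]; rewrite -leqNgt => li il.
have [-> | /max_l il'] := eqVneq (a i) 0; first by rewrite mul0r.
by case/eqP: il; apply/val_inj/eqP; rewrite eqn_leq li andbT.
Qed.

Lemma point_span (y : Zpoint p k) : [ffun x => (x == y)%:R] \in W.
Proof.
have D_neq0 : (p ^ k.+1)%N%:R - (p ^ k)%N%:R != 0 :> R[i].
  by rewrite subr_eq0 eqr_nat eqn_exp2l // eqn_leq ltnn.
(* By [sum_dual_kernel] at [z = x - y], the sum of the indicators is [p ^ k.+1] at [y] and [p ^ k]
   elsewhere: subtract the smaller value and divide by the gap. *)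
have -> : [ffun x : Zpoint p k => (x == y)%:R] =
    ((p ^ k.+1)%N%:R - (p ^ k)%N%:R : R[i])^-1 *:
    (\sum_(a : {ffun 'I_k.+1 -> 'Z_p})
        [ffun x : Zpoint p k =>
           (\sum_i a i * x i + (- \sum_i a i * y i) == 0)%:R]
     - ((p ^ k)%N%:R : R[i]) *: const1 R p k).
  apply/ffunP => x; rewrite !ffunE sum_ffunE.
  have -> : \sum_(a : {ffun 'I_k.+1 -> 'Z_p})
        ([ffun x : Zpoint p k =>
           (\sum_i a i * x i + (- \sum_i a i * y i) == 0)%:R] : Vfun R p k) x =
      (if (x - y == 0)%R then p ^ k.+1 else p ^ k)%N%:R.
    rewrite -sum_dual_kernel // natr_sum; apply: eq_bigr => a _.
    rewrite ffunE -sumrB; congr (nat_of_bool (_ == _))%:R.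
    by apply: eq_bigr => i _; rewrite !ffunE mulrBr.
  rewrite subr_eq0 /GRing.scale /= mulr1.
  by case: eqP => _; [rewrite mulVf | rewrite subrr mulr0].
rewrite rpredZ // rpredB ?rpredZ ?const1_span // rpred_sum // => a _.
exact: hyperplane_span.
Qed.

Lemma calF_spans : (fullv <= W)%VS.
Proof.
apply/subvP => f _.
have -> : f = \sum_y f y *: ([ffun x => (x == y)%:R] : Vfun R p k).
  apply/ffunP => x; rewrite sum_ffunE (bigD1 x) //= big1 => [|y /negPf yx].
    by rewrite !ffunE eqxx /GRing.scale /= mulr1 addr0.
  by rewrite !ffunE eq_sym yx scaler0.
by apply: rpred_sum => y _; rewrite rpredZ ?point_span.
Qed.

(** Counts the parameters [(a, b)]; coincidences between functions could only make the set
    smaller. *)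
Lemma card_F_le (l : 'I_k.+1) : (#|` F_ R p l| <= p ^ l * p.-1)%N.
Proof.
have -> : (p ^ l * p.-1 =
    size [seq affine_fun R a b | a <- enum {ffun 'I_l -> 'Z_p},
                                 b <- enum 'I_p.-1])%N.
  by rewrite size_allpairs -!cardE card_Zp_ffun // !card_ord.
apply: uniq_leq_size; first exact: fset_uniq.
move=> f /imfset2P[a _ [b _ ->]].
by apply/allpairsP; exists (a, b); rewrite !mem_enum.
Qed.

Lemma size_calF_le : (size (calF R p k) <= p ^ k.+1)%N.
Proof.
(* Geometric sum; the final 1 accounts for the constant function. *)
have -> : (p ^ k.+1 = \sum_(l < k.+1) p.-1 * p ^ l + 1)%N.
  by rewrite -big_distrr /= -predn_exp addn1 prednK // expn_gt0 prime_gt0.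
have fsetU_le (A B : {fset Vfun R p k}) : (#|` (A `|` B)%fset| <= #|` A| + #|` B|)%N.
  by rewrite cardfsU leq_subr.
apply: leq_trans (fsetU_le _ _) _; rewrite cardfs1 leq_add2r.
apply: (big_ind2 (fun (A : {fset Vfun R p k}) n => #|` A| <= n)%N).
- by rewrite cardfs0.
- by move=> A m B n Am Bn; apply: leq_trans (fsetU_le _ _) (leq_add Am Bn).
- by move=> l _; rewrite mulnC card_F_le.
Qed.

Lemma dim_Vfun : \dim (fullv : {vspace Vfun R p k}) = (p ^ k.+1)%N.
Proof. by rewrite dimvf /dim /= muln1 card_Zp_ffun // card_ord. Qed.

End Span.

Theorem theorem5p26 (R : realType) (p k : nat) (p_prime : prime p) :
  free (calF R p k) /\ basis_of (fullv : {vspace Vfun R p k}) (calF R p k).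
Proof.
have basisF : basis_of (fullv : {vspace Vfun R p k}) (calF R p k).
  (* A spanning family with at most as many members as the dimension is a basis, hence free. *)
  by rewrite basisEdim calF_spans // dim_Vfun // size_calF_le.
by split; first exact: basis_free basisF.
Qed.
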